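(* For every $\alpha\ge 0$ and every $\beta$ with $0<\beta<4/3$, $$\limsup_{c\to\infty}s_c=\infty,$$ where $s_{c_0}=\sup\{q_C(a,b,c_0;\alpha,\beta):(a,b,c_0)\text{ is an abc-triple}\}$.
   Context: An abc-triple is a triple $(a,b,c)$ of positive integers with $a+b=c$ and $\gcd(a,b)=\gcd(b,c)=\gcd(a,c)=1$; $\omega=\omega(abc)$ is the number of distinct primes $p_1,\dots,p_{\omega}$ dividing $abc$. For $\alpha\ge0$, $\beta>0$, the DGM quality class is $$q_C(a,b,c;\alpha,\beta)=\frac{\ln c}{(\ln \mathrm{DGM}(U))^\beta},\qquad U=\{p_i^{\omega^\alpha}: p_i\mid abc,\ p_i\text{ prime}\},$$ where $\mathrm{DGM}(\{x_1,\dots,x_m\})=\exp(\exp(\tfrac1m\sum_{i}\ln\ln x_i))$; equivalently $q_C(a,b,c;\alpha,\beta)=\ln c\,\big/\,\big(\omega^\alpha(\prod_{i=1}^{\omega}\ln p_i)^{1/\omega}\big)^\beta$. *)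

(* Defs.v *)
From mathcomp Require Import all_boot all_order all_algebra.
From mathcomp Require Import all_classical all_reals all_analysis.
Set Implicit Arguments.
Unset Strict Implicit.
Unset Printing Implicit Defensive.
Import Order.TTheory GRing.Theory Num.Theory.
Local Open Scope ring_scope.

Definition abc_triple (a b c : nat) : Prop :=
  [/\ (0 < a)%N, (0 < b)%N, (0 < c)%N & (a + b = c)%N] /\
  [/\ gcdn a b = 1%N, gcdn b c = 1%N & gcdn a c = 1%N].

Definition omega (n : nat) : nat := size (primes n).

(* Finite sets are duplicate-free sequences.  The inner logarithm [ln x] must
   be positive ([ln] is 0 outside the positive reals), i.e. all x > 1. *)
Definition DGM (R : realType) (xs : seq R) : R :=
  expR (expR ((size xs)%:R^-1 * \sum_(x <- xs) ln (ln x))).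

(* [primes (a * b * c)] is duplicate-free and p |-> p `^ (omega `^ alpha) is
   injective on it, so this sequence represents the set U. *)
Definition Uset (R : realType) (a b c : nat) (alpha : R) : seq R :=
  [seq p%:R `^ ((omega (a * b * c))%:R `^ alpha) | p <- primes (a * b * c)].

Definition qC (R : realType) (a b c : nat) (alpha beta : R) : R :=
  ln c%:R / ln (DGM (Uset a b c alpha)) `^ beta.

(* For c < 2 there is no abc-triple, and the supremum is -oo. *)
Definition s_sup (R : realType) (alpha beta : R) (c0 : nat) : \bar R :=
  ereal_sup [set q | exists a b : nat,
    abc_triple a b c0 /\ q = (qC a b c0 alpha beta)%:E]%classic.

(* Main.v *)
Require Import Defs.
From mathcomp Require Import all_boot all_order all_algebra.
From mathcomp Require Import all_classical all_reals all_analysis.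
From mathcomp Require Import zify lra.
Import Order.TTheory GRing.Theory Num.Theory.

(** Take the triples (1, P m, P m + 1), where P has at least s = 4 (j + 3)
    distinct prime factors while ln P is only polynomial in j.  Since
    2^omega(n) is at most the number of divisors of n, which is O(ln n) on
    average along a progression of modulus coprime to its residue, some
    m >= M = 2^(2^j) makes both omega(m) and omega(P m + 1) at most j + 3.
    Hence at least two thirds of the primes dividing abc divide P, and their
    logarithms are polynomial in j; the others have logarithm at most ln c, so
    the geometric mean of the logarithms is at most poly(j) * (ln c)^(1/3).
    As omega is polynomial in j too, while ln c grows like 2^j, the quality is
    at least (ln c)^(1 - beta/3) / poly(j), which is unbounded. *)

Local Open Scope nat_scope.

(** * Divisor counts on average along a progression *)

(** Write [n] as [m] times a power of [p]. For [d] dividing [m], both [d] and [p * d] divide [n],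
    without repetition as [p] does not divide [m]; so removing one prime at least halves the number
    of divisors. *)
Lemma exp2_omega_le_divisors (n : nat) :
  0 < n -> 2 ^ omega n <= size (divisors n).
Proof.
elim/ltn_ind: n => n IHn n_gt0.
have [n_le1 | n_gt1] := leqP n 1.
  by have -> : n = 1 by lia.
set p := pdiv n; have p_pr : prime p := pdiv_prime n_gt1.
have [m co_pm def_n] := pfactor_coprime p_pr n_gt0.
have k_gt0 : 0 < logn p n by rewrite logn_gt0 mem_primes p_pr n_gt0 pdiv_dvd.
have m_gt0 : 0 < m by move: n_gt0; rewrite def_n muln_gt0 => /andP[].
have dv_pm : p * m %| n by rewrite def_n mulnC dvdn_pmul2l // dvdn_exp.
have lt_mn : m < n.
  by apply: leq_trans (dvdn_leq n_gt0 dv_pm); rewrite ltn_Pmull ?prime_gt1.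
have le_omega : omega n <= (omega m).+1.
  rewrite /omega -[_.+1]/(size (p :: primes m)).
  apply: uniq_leq_size (primes_uniq n) _ => q.
  rewrite inE !mem_primes n_gt0 m_gt0 => /= /andP[q_pr].
  rewrite {1}def_n Euclid_dvdM // Euclid_dvdX // (dvdn_prime2 q_pr p_pr) q_pr.
  by case/orP => [-> | /andP[-> _]]; rewrite ?orbT.
apply: leq_trans (leq_pexp2l _ le_omega) _ => //; rewrite expnS mul2n.
apply: (@leq_trans (size (divisors m)).*2); first by rewrite leq_double IHn.
rewrite -addnn -{2}(size_map (muln p) (divisors m)) -size_cat.
apply: uniq_leq_size.
  rewrite cat_uniq divisors_uniq map_inj_uniq ?divisors_uniq ?andbT /=.
    apply/hasPn => _ /mapP[d _ ->] /=; rewrite -dvdn_divisors //.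
    apply/negP => /(dvdn_trans (dvdn_mulr d (dvdnn p))) p_m.
    by move: co_pm; rewrite prime_coprime // p_m.
  by move=> d1 d2 /eqP; rewrite eqn_pmul2l ?prime_gt0 // => /eqP.
move=> d; rewrite mem_cat -!dvdn_divisors // => /orP[dm|/mapP[d' + ->]].
  by rewrite (dvdn_trans dm) // (dvdn_trans _ dv_pm) // dvdn_mull.
rewrite -dvdn_divisors // => dm.
by rewrite (dvdn_trans _ dv_pm) // dvdn_pmul2l ?prime_gt0.
Qed.

(* Each pair of complementary divisors (d, n / d) has a member below q. *)
Lemma size_divisors_le (n q : nat) : 0 < n -> n < q ^ 2 ->
  size (divisors n) <= 2 * count (fun e => e %| n) (index_iota 1 q).
Proof.
move=> n_gt0 lt_nq; set s := seq.filter (fun e => e %| n) (index_iota 1 q).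
rewrite -size_filter -/s mul2n -addnn.
rewrite -{2}(size_map (fun e => n %/ e) s) -size_cat.
apply: uniq_leq_size (divisors_uniq n) _ => d; rewrite -dvdn_divisors // => dn.
have d_gt0 := dvdn_gt0 n_gt0 dn; have def_n := divnK dn.
rewrite mem_cat mem_filter dn mem_index_iota d_gt0 /=.
have [//|le_qd] := ltnP d q.
apply/mapP; exists (n %/ d); last by rewrite divnA // mulKn.
rewrite mem_filter mem_index_iota dvdn_div // divn_gt0 // dvdn_leq //=.
by nia.
Qed.

(** A divisor [e] of [q * m + r] is coprime to [q], so the counted [m] lie in one residue class
    modulo [e] and [(m - a) %/ e] tells them apart. *)
Lemma count_dvd_affine (e q r a N : nat) : 0 < e -> coprime q r ->
  count (fun m => e %| q * m + r) (index_iota a (a + N)) <= (N %/ e).+1.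
Proof.
move=> e_gt0 co_qr; rewrite -size_filter; set s := seq.filter _ _.
rewrite -(size_map (fun x => (x - a) %/ e)) -(size_iota 0 (N %/ e).+1).
apply: uniq_leq_size.
  rewrite map_inj_in_uniq ?filter_uniq ?iota_uniq //.
  move=> x y; rewrite !mem_filter !mem_index_iota.
  move=> /andP[ex /andP[ax _]] /andP[ey /andP[ay _]] eq_xy.
  have co_eq : coprime e q.
    apply: coprime_dvdl ex _; rewrite coprime_sym.
    by rewrite /coprime mulnC gcdnMDl.
  wlog le_xy : x y ex ey ax ay eq_xy / x <= y => [IH|].
    have [/IH|/ltnW/IH/esym] := leqP x y; by [apply|move=> H; apply/esym/H].
  have : e %| q * (y - x).
    by rewrite mulnBr -(subnDr r) dvdn_sub.
  rewrite Gauss_dvdr // => /dvdnP[k def_k].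
  have def_y : y - a = k * e + (x - a) by lia.
  by move: eq_xy; rewrite def_y divnMDl //; lia.
move=> _ /mapP[x + ->].
rewrite mem_filter mem_index_iota mem_iota => /andP[_ ?].
by rewrite add0n ltnS leq_div2r //; lia.
Qed.

(* Dyadic blocks: each [2 ^ i, 2 ^ i.+1) contributes at most N. *)
Lemma sum_divn_dyadic (N k : nat) : \sum_(1 <= e < 2 ^ k) N %/ e <= N * k.
Proof.
elim: k => [|k IHk]; first by rewrite big_geq.
rewrite (big_cat_nat (n := 2 ^ k)) ?expn_gt0 ?leq_pexp2l //=.
rewrite mulnS addnC leq_add //.
rewrite (@leq_trans (\sum_(2 ^ k <= e < 2 ^ k.+1) N %/ 2 ^ k)) //.
  rewrite big_seq [leqRHS]big_seq leq_sum // => e.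
  by rewrite mem_index_iota => /andP[? _]; rewrite leq_div2l ?expn_gt0.
rewrite sum_nat_const_nat expnS mul2n -addnn addnK mulnC; exact: leq_trunc_div.
Qed.

(** The size hypothesis leaves only divisors [e < 2 ^ k.+1] to count, at the cost of a factor 2.
    After exchanging the sums, each [e] has at most [2 ^ k %/ e + 1] hits: the quotients give
    [k + 1], the ones give the remaining 2. *)
Lemma sum_exp2_omega_affine (k q r : nat) : coprime q r -> 0 < q + r ->
  (forall m, 2 ^ k <= m -> m < 2 ^ k.+1 -> q * m + r < (2 ^ k.+1) ^ 2) ->
  \sum_(2 ^ k <= m < 2 ^ k.+1) 2 ^ omega (q * m + r) <= 2 ^ k.+1 * (k + 3).
Proof.
move=> co_qr qr_gt0 bound.
apply: (@leq_trans (\sum_(2 ^ k <= m < 2 ^ k.+1)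
    \sum_(1 <= e < 2 ^ k.+1) 2 * (e %| q * m + r))).
  rewrite big_seq [leqRHS]big_seq leq_sum // => m.
  rewrite mem_index_iota => /andP[km mk].
  have n_gt0 : 0 < q * m + r by have := expn_gt0 2 k; nia.
  apply: leq_trans (exp2_omega_le_divisors _ n_gt0) _.
  apply: leq_trans (size_divisors_le _ _ n_gt0 (bound m km mk)) _.
  by rewrite -big_distrr /= -sum1_count big_mkcond.
rewrite exchange_big /=.
apply: (@leq_trans (\sum_(1 <= e < 2 ^ k.+1) (2 * (2 ^ k %/ e) + 2))).
  rewrite big_seq [leqRHS]big_seq leq_sum // => e.
  rewrite mem_index_iota => /andP[e_gt0 _].
  rewrite -big_distrr /= -mulnSr leq_mul2l /=.
  have := @count_dvd_affine e q r (2 ^ k) (2 ^ k) e_gt0 co_qr.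
  by rewrite addnn -mul2n -expnS -sum1_count [in leqLHS]big_mkcond.
rewrite big_split /= -big_distrr /= sum_nat_const_nat.
have := sum_divn_dyadic (2 ^ k) k.+1; rewrite expnS; lia.
Qed.

(** Averaging: if every [m] in the block violated one of the bounds, the two sums together would
    exceed [2 ^ k * (4 * (k + 3))], which is their joint upper bound. *)
Lemma exists_small_omega (k q : nat) : 0 < q <= 2 ^ k ->
  exists m, [/\ 2 ^ k <= m, 2 ^ omega m <= 4 * (k + 3)
    & 2 ^ omega (q * m + 1) <= 4 * (k + 3)].
Proof.
move=> /andP[q_gt0 le_qk].
have S1 : \sum_(2 ^ k <= m < 2 ^ k.+1) 2 ^ omega (1 * m + 0)
    <= 2 ^ k.+1 * (k + 3).
  apply: sum_exp2_omega_affine => // m _.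
  by have := expn_gt0 2 k; rewrite expnS; nia.
have S2 : \sum_(2 ^ k <= m < 2 ^ k.+1) 2 ^ omega (q * m + 1)
    <= 2 ^ k.+1 * (k + 3).
  apply: sum_exp2_omega_affine; rewrite ?coprimen1 ?addn1 // => m _.
  by have := expn_gt0 2 k; rewrite expnS; nia.
set good := fun m =>
  (2 ^ omega m <= 4 * (k + 3)) && (2 ^ omega (q * m + 1) <= 4 * (k + 3)).
have [/hasP[m]|/hasPn none] := boolP (has good (index_iota (2 ^ k) (2 ^ k.+1))).
  by rewrite mem_index_iota => /andP[km _] /andP[? ?]; exists m.
suff : \sum_(2 ^ k <= m < 2 ^ k.+1) (4 * (k + 3)).+1 <=
  \sum_(2 ^ k <= m < 2 ^ k.+1) (2 ^ omega (1 * m + 0) + 2 ^ omega (q * m + 1)).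
  rewrite sum_nat_const_nat big_split /=; move: S1 S2; have := expn_gt0 2 k.
  by rewrite expnS; nia.
rewrite big_seq [leqRHS]big_seq leq_sum // => m /none.
by rewrite /good mul1n addn0 negb_and -!ltnNge => /orP[]; lia.
Qed.

(** * Numbers with many small prime factors; choice of [P] and [m] *)

Lemma omegaM_leq (m n : nat) :
  0 < m -> 0 < n -> omega (m * n) <= omega m + omega n.
Proof.
move=> m_gt0 n_gt0; rewrite /omega -size_cat.
by apply: uniq_leq_size (primes_uniq _) _ => p; rewrite primesM // mem_cat.
Qed.

Lemma omegaM_coprime_geq (m n : nat) : 0 < m -> 0 < n -> coprime m n ->
  omega m + omega n <= omega (m * n).
Proof.
move=> m_gt0 n_gt0 co_mn; rewrite /omega -size_cat; apply: uniq_leq_size.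
  rewrite cat_uniq !primes_uniq andbT /= -coprime_has_primes //.
by move=> p; rewrite primesM // mem_cat.
Qed.

Lemma omega_le_log2 (k n : nat) : 0 < n -> n <= 2 ^ k -> omega n <= k.
Proof.
move=> n_gt0 le_nk; rewrite -(leq_exp2l (m := 2)) //.
apply: leq_trans (exp2_omega_le_divisors n n_gt0) (leq_trans _ le_nk).
rewrite -[leqRHS](size_iota 1); apply: uniq_leq_size (divisors_uniq n) _ => d.
rewrite -dvdn_divisors // mem_iota => dn.
by rewrite (dvdn_gt0 n_gt0 dn) add1n ltnS dvdn_leq.
Qed.

(** A common divisor divides the difference, which is [k - i] times the factorial of [s]. Since
    [k - i] divides that factorial, coprimality of [x] to the factorial suffices. *)
Lemma coprime_fact_progression (s i k : nat) : 0 < i -> i < k -> k <= s ->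
  coprime (s`! * i + 1) (s`! * k + 1).
Proof.
move=> i_gt0 lt_ik le_ks; set x := s`! * i + 1; set y := s`! * k + 1.
have co_xs : coprime x s`!.
  by rewrite coprime_sym /x mulnC /coprime gcdnMDl gcdn1.
have dv_ki : k - i %| s`! by apply: dvdn_fact; lia.
have def_y : y = x + s`! * (k - i) by rewrite /x /y; nia.
rewrite def_y /coprime gcdnDl -/(coprime _ _) coprimeMr co_xs /=.
exact: coprime_dvdr dv_ki co_xs.
Qed.

Lemma fact_leq_exp2 (n : nat) : n`! <= 2 ^ (n ^ 2).
Proof.
elim: n => // n IHn; rewrite factS.
apply: (@leq_trans (2 ^ n.+1 * 2 ^ (n ^ 2))); last first.
  by rewrite -expnD leq_exp2l //; nia.
by apply: leq_mul; rewrite // ltnW // ltn_expl.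
Qed.

(* P is the product of the pairwise coprime numbers s! * i + 1, 1 <= i <= s. *)
Lemma exists_many_small_primes (s : nat) :
  exists P, [/\ 0 < P, P <= 2 ^ (s.+1 ^ 3) & s <= omega P].
Proof.
(* The last clause keeps the factors still to come coprime to the product so far, so that each of
   them brings a new prime. *)
have many n : n <= s -> exists P, [/\ 0 < P, P <= s.+1`! ^ n, n <= omega P
    & forall k, n < k <= s -> coprime P (s`! * k + 1)].
  elim: n => [|n IHn] le_ns.
    by exists 1; split=> // k _; rewrite coprime1n.
  have [P [P_gt0 P_le P_om P_co]] := IHn (ltnW le_ns).
  exists (P * (s`! * n.+1 + 1)); split.
  - by rewrite muln_gt0 P_gt0 addn1.
  - by rewrite expnSr leq_mul // factS; have := fact_gt0 s; nia.
  - apply: leq_trans (omegaM_coprime_geq _ _ P_gt0 _ _);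
      rewrite ?addn1 //; last first.
      by rewrite -addn1 P_co // leqnn.
    rewrite -[n.+1]addn1 leq_add // lt0n size_eq0 primes_eq0.
    by have := fact_gt0 s; nia.
  - move=> k /andP[lt_nk le_ks]; rewrite coprimeMl P_co ?le_ks ?(ltnW lt_nk) //.
    exact: coprime_fact_progression.
have [P [P_gt0 P_le P_om _]] := many s (leqnn s); exists P; split=> //.
apply: leq_trans P_le _; apply: (@leq_trans ((2 ^ (s.+1 ^ 2)) ^ s)).
  have [->//|s_gt0] := posnP s; by rewrite leq_exp2r ?fact_leq_exp2.
by rewrite -expnM leq_exp2l //; nia.
Qed.

(** This makes [P] at most [2 ^ (2 ^ j)]. The base case is [93 ^ 3 <= 2 ^ 20]; from 93 on, adding 4
    at most doubles the cube. *)
Lemma cubic_le_exp2 (j : nat) : 20 <= j -> (4 * j + 13) ^ 3 <= 2 ^ j.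
Proof.
elim: j => // j IHj; rewrite leq_eqVlt => /orP[/eqP<-|j_ge]; first by lia.
rewrite (expnS 2) (leq_trans _ (leq_mul (leqnn 2) (IHj j_ge))) //.
have -> : 4 * j.+1 + 13 = 4 * j + 13 + 4 by lia.
have : 93 <= 4 * j + 13 by lia.
move: (4 * j + 13) => x x_ge; rewrite !(expnS _ 2) -!mulnn.
have : 93 * x <= x * x by rewrite leq_mul2r x_ge orbT.
have : 93 * (x * x) <= x * (x * x) by rewrite leq_mul2r x_ge orbT.
nia.
Qed.

Lemma exists_pair_omega (j : nat) : 20 <= j -> exists P m,
  [/\ 0 < P <= 2 ^ ((4 * j + 13) ^ 3), 4 * (j + 3) <= omega P,
      2 ^ (2 ^ j) <= m & omega m + omega (P * m + 1) <= 2 * (j + 3)].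
Proof.
move=> j_ge.
have [P [P_gt0 P_le P_om]] := exists_many_small_primes (4 * (j + 3)).
have def_s : 4 * j + 13 = (4 * (j + 3)).+1 by lia.
rewrite def_s; have P_M : 0 < P <= 2 ^ (2 ^ j).
  rewrite P_gt0 (leq_trans P_le) // leq_exp2l //.
  by rewrite -def_s cubic_le_exp2.
have [m [m_ge om1 om2]] := exists_small_omega _ _ P_M.
exists P, m; split; rewrite ?P_gt0 //.
(* The averaging bound becomes a power of 2, so that comparing exponents gives [j + 3] for each
   [omega]. *)
have le8 : 4 * (2 ^ j + 3) <= 2 ^ (j + 3).
  by have := cubic_le_exp2 _ j_ge; rewrite expnD; nia.
have := leq_trans om1 le8; have := leq_trans om2 le8.
by rewrite !leq_exp2l //; lia.
Qed.

Local Open Scope ring_scope.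

(** * Geometric mean of the logarithms and lower bound for the quality *)

Lemma ln_DGM_Uset (R : realType) (a b c : nat) (alpha : R) :
  let n := (a * b * c)%N in (0 < omega n)%N ->
  ln (DGM (Uset a b c alpha)) =
  expR (alpha * ln (omega n)%:R
        + (omega n)%:R^-1 * \sum_(p <- primes n) ln (ln p%:R)).
Proof.
move=> n om_gt0; rewrite /DGM /Uset -/n expRK size_map -/(omega n) big_map.
congr expR.
have omR : 0 < (omega n)%:R :> R by rewrite ltr0n.
rewrite (eq_big_seq (fun p => alpha * ln (omega n)%:R + ln (ln p%:R)));
  last first.
  move=> p; rewrite mem_primes => /andP[p_pr _].
  rewrite ln_powR lnM ?posrE ?powR_gt0 ?ln_powR //.
  by rewrite ln_gt0 // ltr1n prime_gt1.
rewrite big_split /= big_const_seq count_predT iter_addr addr0 -/(omega n).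
by rewrite mulrDr -[(alpha * _) *+ _]mulr_natl mulKf // lt0r_neq0.
Qed.

Lemma lnln_le (R : realType) (n m : nat) : (1 < n <= m)%N ->
  ln (ln n%:R) <= ln (ln m%:R) :> R.
Proof.
move=> /andP[n_gt1 le_nm].
have n0 : 0 < n%:R :> R by rewrite ltr0n ltnW.
have m0 : 0 < m%:R :> R by rewrite ltr0n (leq_trans _ le_nm) // ltnW.
have lnm : ln n%:R <= ln m%:R :> R by rewrite ler_ln ?posrE // ler_nat.
have ln0 : 0 < ln n%:R :> R by rewrite ln_gt0 // ltr1n.
by rewrite ler_ln ?posrE // (lt_le_trans ln0).
Qed.

(** The primes of [n] outside [P] are at most a third of all; only they are charged [lam], which
    yields the weight 1/3. *)
Lemma sum_lnln_primes (R : realType) (P n : nat) (l lam : R) :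
  (0 < n)%N -> (P %| n)%N -> (2 * omega n <= 3 * omega P)%N ->
  0 <= l -> 0 <= lam ->
  (forall p, p \in primes P -> ln (ln p%:R) <= l) ->
  (forall p, p \in primes n -> ln (ln p%:R) <= lam) ->
  \sum_(p <- primes n) ln (ln p%:R) <= (omega n)%:R * (l + lam / 3).
Proof.
move=> n_gt0 Pn om3 l0 lam0 hP hn.
have P_gt0 := dvdn_gt0 n_gt0 Pn.
have primesP : primes P = [seq p <- primes n | p %| P]%N.
  apply: lt_sorted_eq; rewrite ?sorted_primes //.
    by apply: sorted_filter; [exact: ltn_trans | exact: sorted_primes].
  move=> p; rewrite mem_filter !mem_primes n_gt0 P_gt0 /=.
  case: (prime p) => //=; last by rewrite andbF.
  by have [pP|//] := boolP (p %| P)%N; rewrite (dvdn_trans pP Pn).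
rewrite (bigID (fun p => p %| P)%N) /=.
have omP : omega P = count (fun p => p %| P)%N (primes n).
  by rewrite /omega primesP size_filter.
have omC : omega n = (omega P + count (fun p => ~~ (p %| P)) (primes n))%N.
  by rewrite omP /omega -(count_predC (fun p => p %| P)%N).
have S1 : \sum_(p <- primes n | (p %| P)%N) ln (ln p%:R) <= (omega P)%:R * l.
  rewrite -big_filter -primesP big_seq (le_trans (ler_sum _ hP)) //.
  by rewrite -big_seq big_const_seq count_predT iter_addr addr0 mulr_natl.
have S2 : \sum_(p <- primes n | ~~ (p %| P)%N) ln (ln p%:R)
    <= (count (fun p => ~~ (p %| P)%N) (primes n))%:R * lam.
  rewrite big_seq_cond (le_trans (y :=
    \sum_(p <- primes n | (p \in primes n) && ~~ (p %| P)%N) lam)) //.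
    by apply: ler_sum => p /andP[pn _]; exact: hn.
  by rewrite -big_seq_cond big_const_seq iter_addr addr0 mulr_natl.
apply: le_trans (lerD S1 S2) _; rewrite omC natrD.
move: om3; rewrite omC; set w := omega P; set t := count _ _ => om3.
have : 3 * t%:R <= (w + t)%N%:R :> R by rewrite -[3]/(3%:R) -natrM ler_nat; lia.
have : 0 <= t%:R :> R by [].
by rewrite natrD; nra.
Qed.

Lemma half_le_ln2 (R : realType) : 2^-1 <= ln 2 :> R.
Proof.
have := @le_ln1Dx R (- 2^-1).
have -> : 1 + - 2^-1 = 2^-1 :> R by lra.
rewrite lnV ?posrE //; lra.
Qed.

Lemma abc_triple_succ (n : nat) : (0 < n)%N -> abc_triple 1 n (n + 1).
Proof.
by move=> n_gt0; split; split; rewrite ?gcd1n ?gcdnDl ?gcdn1 // ?addn1 ?add1n.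
Qed.

(** With [lam] the double logarithm of [c] and [X] that of the DGM, the quality is
    [expR (lam - beta * X)]. The term [lam / 3] in the bound for [X] leaves [(1 - beta / 3) * lam],
    at least [lam / 2] for [beta < 3 / 2], and [lam] is at least [(j - 1) / 2]. *)
Lemma exists_triple_qC_ge (R : realType) (alpha beta : R) (j : nat) :
  0 <= alpha -> 0 < beta -> beta < 3 / 2 -> (20 <= j)%N ->
  exists a b c : nat, [/\ abc_triple a b c, (j <= c)%N &
    expR ((j%:R - 1) / 4 - beta * (alpha + 1) * ln (2 * (4 * j + 13) ^ 3)%N%:R)
    <= qC a b c alpha beta].
Proof.
move=> alpha0 beta0 beta_lt j_ge.
have [P [m [/andP[P_gt0 P_le] P_om m_ge om_le]]] := exists_pair_omega j j_ge.
(* [K] bounds the binary logarithm of [P], hence [omega P]. Its double [T] bounds both [omega n] and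
   [ln p] for [p] dividing [P], so one [l] serves for both. *)
set K := ((4 * j + 13) ^ 3)%N in P_le *; set T := (2 * K)%N.
have K_ge : (4 * (j + 3) <= K)%N by rewrite /K; nia.
clearbody K.
have m_gt0 : (0 < m)%N by apply: leq_trans m_ge; rewrite expn_gt0.
set c := (P * m + 1)%N in om_le.
have c_ge : (2 ^ (2 ^ j) <= c)%N by rewrite /c; nia.
have Pm_gt0 : (0 < P * m)%N by rewrite muln_gt0 P_gt0.
have j_c : (j <= c)%N.
  apply: leq_trans c_ge.
  by do 2 apply: leq_trans (ltnW (ltn_expl _ (isT : 1 < 2)%N)).
exists 1%N, (P * m)%N, c; split; [exact: abc_triple_succ | exact: j_c | ].
set n := (1 * (P * m) * c)%N.
have c_gt1 : (1 < c)%N by rewrite /c; lia.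
have n_gt0 : (0 < n)%N by rewrite /n mul1n muln_gt0 Pm_gt0 ltnW.
have Pn : (P %| n)%N by rewrite /n mul1n -mulnA dvdn_mulr.
have om_n : (omega n <= omega P + (omega m + omega c))%N.
  rewrite /n mul1n addnA (leq_trans (omegaM_leq _ _ Pm_gt0 (ltnW c_gt1))) //.
  by rewrite leq_add2r omegaM_leq.
have omP_le : (omega P <= K)%N by apply: omega_le_log2.
have om_P_n : (omega P <= omega n)%N.
  apply: uniq_leq_size (primes_uniq _) _ => p.
  by rewrite !mem_primes n_gt0 => /and3P[-> _ /dvdn_trans->].
have om_gt0 : (0 < omega n)%N by lia.
have T_gt0 : (0 < T)%N by rewrite /T; lia.
set lam : R := ln (ln c%:R).
have lnc_ge : 2^-1 * 2 ^+ j <= ln c%:R :> R.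
  apply: (@le_trans _ _ (ln (2 ^+ (2 ^ j)%N))).
    rewrite lnXn // -[ln _ *+ _]mulr_natr natrX ler_pM ?invr_ge0 ?exprn_ge0 //.
    exact: half_le_ln2.
  by rewrite -natrX ler_ln ?posrE ?ltr0n ?ler_nat ?expn_gt0 // ltnW.
have lnc_gt0 : 0 < ln c%:R :> R by rewrite ln_gt0 // ltr1n.
have lam_ge : (j%:R - 1) / 2 <= lam.
  apply: (@le_trans _ _ (ln (2^-1 * 2 ^+ j))); last first.
    by rewrite ler_ln ?posrE // mulr_gt0 ?exprn_gt0.
  rewrite lnM ?posrE ?exprn_gt0 // lnV ?posrE // lnXn // -[ln _ *+ _]mulr_natl.
  have : 1 <= j%:R :> R by rewrite ler1n; lia.
  by have := half_le_ln2 R; nra.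
have lam_ge0 : 0 <= lam.
  by apply: le_trans lam_ge; have : 1 <= j%:R :> R by [rewrite ler1n; lia]; lra.
set l : R := ln T%:R.
have l_ge0 : 0 <= l by rewrite ln_ge0 // ler1n.
have lnP_le p : p \in primes P -> ln (ln p%:R) <= l.
  rewrite mem_primes => /and3P[p_pr _ pP].
  have ln_p : 0 < ln p%:R :> R by rewrite ln_gt0 // ltr1n prime_gt1.
  rewrite /l ler_ln ?posrE ?ltr0n //.
  apply: (@le_trans _ _ (ln (2 ^+ K))).
    rewrite -natrX ler_ln ?posrE ?ltr0n ?expn_gt0 ?prime_gt0 // ler_nat.
    exact: leq_trans (dvdn_leq P_gt0 pP) P_le.
  rewrite lnXn // -[ln _ *+ _]mulr_natr /T natrM ler_wpM2r //.
  exact/ltW/ln_sublinear.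
have lnn_le p : p \in primes n -> ln (ln p%:R) <= lam.
  rewrite mem_primes => /and3P[p_pr _]; rewrite /n mul1n => p_n.
  apply: lnln_le; rewrite prime_gt1 //=.
  move: p_n; rewrite Euclid_dvdM // => /orP[] /dvdn_leq H.
    by apply: leq_trans (H Pm_gt0) _; rewrite /c leq_addr.
  exact: H (ltnW c_gt1).
(* At most [2 * (j + 3)] primes come from [m] and [c], which is at most half of [omega P]. *)
have om3 : (2 * omega n <= 3 * omega P)%N by lia.
have S := @sum_lnln_primes R P n l lam n_gt0 Pn om3 l_ge0 lam_ge0 lnP_le lnn_le.
have ln_om : ln (omega n)%:R <= l.
  by rewrite /l ler_ln ?posrE ?ltr0n // ler_nat /T; lia.
rewrite /qC ln_DGM_Uset //= -/n.
set X := _ + _ * _; have X_le : X <= (alpha + 1) * l + lam / 3.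
  have : (omega n)%:R^-1 * \sum_(p <- primes n) ln (ln p%:R) <= l + lam / 3.
    by rewrite mulrC ler_pdivrMr ?ltr0n // mulrC.
  by rewrite /X; nra.
rewrite -expRM -{1}(lnK (x := ln c%:R)) ?posrE // -/lam -expRB ler_expR.
have : beta * X <= beta * ((alpha + 1) * l + lam / 3) by rewrite ler_pM2l.
rewrite (mulrC X); nra.
Qed.

(** * Unboundedness of the quality *)

(** With [j] equal to [i ^ 2], the crude bound [ln i <= i] is enough: the loss is linear in [i], the
    gain quadratic. The constant 250 is [2 * 5 ^ 3], from [13 <= i ^ 2]. *)
Lemma ln_poly_bound (R : realType) (i : nat) : (5 <= i)%N ->
  ln (2 * (4 * i ^ 2 + 13) ^ 3)%N%:R <= 250 + 6 * i%:R :> R.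
Proof.
move=> i_ge; have i_gt0 : 0 < i%:R :> R by rewrite ltr0n; lia.
have T_gt0 : (0 < 2 * (4 * i ^ 2 + 13) ^ 3)%N.
  by rewrite muln_gt0 expn_gt0 addn_gt0 orbT.
have T_le : (2 * (4 * i ^ 2 + 13) ^ 3 <= 250 * i ^ 6)%N.
  have -> : (250 * i ^ 6 = 2 * (5 * i ^ 2) ^ 3)%N by rewrite expnMn -expnM; lia.
  by rewrite leq_mul2l leq_exp2r //; nia.
move: (2 * (4 * i ^ 2 + 13) ^ 3)%N T_gt0 T_le => T T_gt0 T_le.
apply: (@le_trans _ _ (ln (250 * i ^ 6)%N%:R)).
  by rewrite ler_ln ?posrE ?ltr0n ?ler_nat // (leq_trans T_gt0).
rewrite natrM natrX.
rewrite lnM ?posrE ?exprn_gt0 // lnXn // -[ln _ *+ 6]mulr_natl lerD //.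
  exact/ltW/ln_sublinear.
by rewrite ler_wpM2l //; exact/ltW/ln_sublinear.
Qed.

Theorem theorem4p7 (R : realType) (alpha beta : R)
    (halpha : 0 <= alpha) (hbeta0 : 0 < beta) (hbeta : beta < 4 / 3) :
  limn_esup (fun c : nat => s_sup alpha beta c) = +oo%E.
Proof.
(* The upper limit is an infimum of suprema over neighbourhoods [V] of infinity, and [V] contains
   every [c >= N]. *)
apply/eqP; rewrite -leye_eq; apply: le_ereal_inf_tmp => _ [V [N _ V_ge] <-].
rewrite leye_eq; apply/eqP/eqyP => A A_gt0.
set g := beta * (alpha + 1); have g_gt0 : 0 < g by rewrite mulr_gt0 ?ltr_wpDl.
(* For [i > x], the gain [i ^ 2 / 4] exceeds [i * x / 4], where [24 * g] pays for [6 * g * i] and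
   the other terms for [250 * g] and [A]. The summands [N] and 5 ensure [N <= i] and [5 <= i]. *)
pose x : R := N%:R + 250 * g + 24 * g + A + 5.
have x_gt0 : 0 <= x by have : 0 <= N%:R :> R by []; rewrite /x; lra.
set i := Num.bound x; have i_gt : x < i%:R := archi_boundP x_gt0.
have N_ge0 : 0 <= N%:R :> R by [].
have i_ge5 : (5 <= i)%N by rewrite -(ler_nat R); move: i_gt; rewrite /x; lra.
have i_geN : (N <= i)%N by rewrite -(ler_nat R); move: i_gt; rewrite /x; lra.
have j_ge : (20 <= i ^ 2)%N by nia.
have beta32 : beta < 3 / 2 by lra.
have [a [b [c [abc c_ge q_ge]]]] :=
  @exists_triple_qC_ge R alpha beta _ halpha hbeta0 beta32 j_ge.
apply: (@le_trans _ _ (s_sup alpha beta c)); last first.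
  by apply: ereal_sup_ubound; exists c => //; apply: V_ge => /=; nia.
apply: (@le_trans _ _ (qC a b c alpha beta)%:E); last first.
  by apply: ereal_sup_ubound; exists a, b.
rewrite lee_fin; apply: le_trans q_ge; apply: le_trans (expR_ge1Dx _).
have := @ln_poly_bound R i i_ge5; rewrite -/g natrX; move: i_gt; rewrite /x.
set L := ln _ => i_gt L_le.
have : g * L <= g * (250 + 6 * i%:R) by rewrite ler_pM2l.
nra.
Qed.
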